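(* Consider the mediated quantum secret sharing protocol described in the context, and suppose that the third party TP performs the collective attack on the qubits that are sent to Alice and the other agents; in order to do so, TP applies a unitary operation $U_e$ on the qubits that complies with the theorems of quantum mechanics. Then no unitary operation exists in the collective attack that allows TP to obtain the information of the participants' secret without being detected.
   Context: **Parties.** A dealer Alice wants to share an $m$-bit secret $S$ with $n$ agents Bob$_1$, …, Bob$_n$ with the help of a third party TP. TP has full quantum capabilities and may be dishonest. Alice and the agents (the participants) can only apply the Hadamard gate $H$ (with $H|0\rangle=\frac{1}{\sqrt2}(|0\rangle+|1\rangle)$, $H|1\rangle=\frac{1}{\sqrt2}(|0\rangle-|1\rangle)$) and measure single qubits in the Z-basis $\{|0\rangle,|1\rangle\}$. Quantum channels, with a predefined noise rate $\varepsilon$, exist only between TP and each participant. The participants share authenticated classical channels (messages can be eavesdropped but not modified). **Protocol.** 1. TP generates any GHZ state $\frac{1}{\sqrt2}\big(|x_1x_2\cdots x_{n+1}\rangle+(-1)^b|\overline{x_1x_2\cdots x_{n+1}}\rangle\big)$ with $x_j,b\in\{0,1\}$ (the bar denotes bitwise complement), sends the first particle to Alice and keeps the others in quantum memory. 2. Alice randomly selects Check or Share mode. In Share mode she applies $H$ to the received qubit and then measures it in the Z-basis; in Check mode she measures it directly in the Z-basis. She stores the result and returns an acknowledgement to TP. 3. After receiving the acknowledgement, TP sends the remaining particles to the agents, one to each. 4. Each agent also randomly selects Check or Share mode, acts on his qubit in the same way as Alice, and stores the result. Steps 1–4 are repeated, with a suggestion of at least $m\times2^{n+1}$ times. 5.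 TP announces all the initial GHZ states, and the agents disclose their modes. In the rounds where all participants selected Check mode, or where at least two participants selected Check mode, the measurement results of the participants in Check mode are announced and used for a security check of TP and eavesdroppers (the results must conform to the measurement results of the announced GHZ state), while the results of participants in Share mode in such rounds are discarded. If the error rate exceeds $\varepsilon$, the session is aborted and the protocol restarted. Otherwise, in the rounds where all participants selected Share mode, the measurement results are kept as raw key bits ($2m$ bits per participant). 6. Alice selects $m$ of the raw key bits as check bits $ck_A^1,\dots,ck_A^m$ and asks every agent Bob$_x$ to announce the corresponding bits $ck_{Bx}^1,\dots,ck_{Bx}^m$. She checks whether $ck_A^j=\bigoplus_{x=1}^{n}ck_{Bx}^j$ for $1\le j\le m$. If the error rate exceeds the preset threshold $\varepsilon$, the session is aborted and the protocol relaunched. 7. Alice and the agents take the remaining $m$ raw bits as their secret keys (shadows) $SK_A, SK_{B1},\dots,SK_{Bn}$. Alice announces $S\oplus SK_A$. 8. Only when all agents collaborate can they recover the secret, via $S\oplus SK_A\oplus\bigoplus_{x=1}^{n}SK_{Bx}=S$. **Terminology.** The participants' secret means Alice's secret and/or the agents' secret shadows. TP is detected if its malicious behavior is revealed by the security checks in steps 5 and 6. In the collective attack, before sending the photons of the GHZ states, TP performs a unitary operation $U_e$ on each GHZ state with an attached probe qubit. TP keeps the probe qubits in its quantum memory and measures them after the completion of the protocol in order to extract the information of the participants' secret. *)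

(* Defs.v *)
From HB Require Import structures.
From mathcomp Require Import all_boot all_order all_algebra.
From mathcomp Require Import reals.
From mathcomp Require Export complex.

Set Implicit Arguments.
Unset Strict Implicit.
Unset Printing Implicit Defensive.

Import Order.TTheory GRing.Theory Num.Theory.
Local Open Scope ring_scope.
Local Open Scope complex_scope.
Local Open Scope sesquilinear_scope.

(* TP is the third party.  There are n.+1 participants: Alice is ord0 and the
   x-th agent is lift ord0 x.  N is the number of rounds and m the length of
   the secret.  A pure state of a register whose Z-basis is indexed by a
   finType T is given by its amplitudes T -> R[i]; an operator on that register
   is a matrix indexed by #|T|, through the enumeration of T. *)

Definition bits (k : nat) := {ffun 'I_k -> bool}.

Definition bxor (k : nat) (u v : bits k) : bits k := [ffun i => u i (+) v i].

Definition bcompl (k : nat) (u : bits k) : bits k := [ffun i => ~~ u i].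

Definition agent (n : nat) (x : 'I_n) : 'I_n.+1 := lift ord0 x.

Definition opmx (R : realType) (T : finType) : Type := 'M[R[i]]_#|T|.

Definition apply_op (R : realType) (T : finType) (A : opmx R T)
    (psi : T -> R[i]) (i : T) : R[i] :=
  \sum_(j : T) A (enum_rank i) (enum_rank j) * psi j.

Definition sqmod (R : realType) (z : R[i]) : R :=
  complex.Re z ^+ 2 + complex.Im z ^+ 2.

(* A pair (x, b) stands for the state (|x> + (-1)^b |~x>) / sqrt 2. *)
Definition ghz_label (n : nat) := (bits n.+1 * bool)%type.

Definition ghz (R : realType) (n : nat) (g : ghz_label n) (z : bits n.+1)
    : R[i] :=
  ((z == g.1)%:R + (-1) ^+ g.2 * (z == bcompl g.1)%:R) / sqrtC 2.

(* U (ghz g (x) probe): the state of the n.+1 transmitted qubits and of the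
   retained probe qubit of one round. *)
Definition attacked (R : realType) (n : nat)
    (U : opmx R (bits n.+1 * bool)%type) (probe : bool -> R[i])
    (g : ghz_label n) (w : bits n.+1 * bool) : R[i] :=
  apply_op U (fun v => ghz R g v.1 * probe v.2) w.

Definition hadamard (R : realType) (a c : bool) : R[i] :=
  (-1) ^+ (a && c) / sqrtC 2.

Definition gate (R : realType) (in_check : bool) (a c : bool) : R[i] :=
  if in_check then (a == c)%:R else hadamard R a c.

(* One round, after the participants in C (those in Check mode) did nothing
   and all the others applied H, just before the Z-measurements. *)
Definition after_gates (R : realType) (n : nat) (C : {set 'I_n.+1})
    (psi : bits n.+1 * bool -> R[i]) (y : bits n.+1) (q : bool) : R[i] :=
  \sum_(z : bits n.+1)
    (\prod_(j < n.+1) gate R (j \in C) (y j) (z j)) * psi (z, q).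

(* y r j is the bit measured by participant j in round r. *)
Definition results (n N : nat) := {ffun 'I_N -> bits n.+1}.

(* chk r is the set of the participants that selected Check mode in round r. *)
Definition modes (n N : nat) := 'I_N -> {set 'I_n.+1}.

(* Amplitude of the results y and of the basis state mem of the N probe
   qubits, all rounds together. *)
Definition amplitude (R : realType) (n N : nat)
    (psi : 'I_N -> bits n.+1 * bool -> R[i]) (chk : modes n N)
    (y : results n N) (mem : bits N) : R[i] :=
  \prod_(r < N) after_gates (chk r) (psi r) (y r) (mem r).

Definition prob_results (R : realType) (n N : nat)
    (psi : 'I_N -> bits n.+1 * bool -> R[i]) (chk : modes n N)
    (E : pred (results n N)) : R :=
  \sum_(y : results n N | E y) \sum_(mem : bits N)
    sqmod (amplitude psi chk y mem).

Definition check_round (n : nat) (C : {set 'I_n.+1}) : bool :=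
  (C == [set: 'I_n.+1]) || (2 <= #|C|)%N.

Definition share_round (n : nat) (C : {set 'I_n.+1}) : bool := C == set0.

(* The results of the participants in C extend to a possible outcome of the
   Z-measurement of all the qubits of the announced state. *)
Definition conforms (R : realType) (n : nat) (g : ghz_label n)
    (C : {set 'I_n.+1}) (y : bits n.+1) : bool :=
  [exists z : bits n.+1,
     (ghz R g z != 0) && [forall j in C, y j == z j]].

(* When there is no check round the rate is 0 / 0 = 0. *)
Definition check_error_rate (R : realType) (n N : nat)
    (g : 'I_N -> ghz_label n) (chk : modes n N) (y : results n N) : R :=
  #|[set r | check_round (chk r) && ~~ conforms R (g r) (chk r) (y r)]|%:R
  / #|[set r | check_round (chk r)]|%:R.

(* The 2m kept raw key bits: the rounds sel (inl j) provide the check bits and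
   the rounds sel (inr j) provide the secret keys. *)
Definition selection (m N : nat) := ('I_m + 'I_m)%type -> 'I_N.

Definition valid_selection (n m N : nat) (chk : modes n N)
    (sel : selection m N) : Prop :=
  injective sel /\ forall k, share_round (chk (sel k)).

Definition key (n m N : nat) (sel : selection m N) (y : results n N)
    (j : 'I_n.+1) : bits m := [ffun i => y (sel (inr i)) j].

Definition shadows (n m N : nat) (sel : selection m N) (y : results n N)
    : {ffun 'I_n -> bits m} := [ffun x => key sel y (agent x)].

Definition check_bits (n m N : nat) (sel : selection m N) (y : results n N)
    (j : 'I_n.+1) : bits m := [ffun i => y (sel (inl i)) j].

Definition parity_error_rate (R : realType) (n m N : nat)
    (sel : selection m N) (y : results n N) : R :=
  #|[set i : 'I_m | check_bits sel y ord0 i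
       != \big[addb/false]_(x < n) check_bits sel y (agent x) i]|%:R / m%:R.

(* "Never detected": whatever the (random) choices of the participants, the
   session is aborted with probability zero. *)
Definition undetected (R : realType) (n m N : nat) (eps : R)
    (g : 'I_N -> ghz_label n) (psi : 'I_N -> bits n.+1 * bool -> R[i])
    : Prop :=
  (forall chk : modes n N,
     prob_results psi chk (fun y => eps < check_error_rate R g chk y) = 0)
  /\
  (forall (chk : modes n N) (sel : selection m N), valid_selection chk sel ->
     prob_results psi chk (fun y => eps < parity_error_rate R sel y) = 0).

Definition completed (R : realType) (n m N : nat) (eps : R)
    (g : 'I_N -> ghz_label n) (chk : modes n N) (sel : selection m N)
    (y : results n N) : bool :=
  (check_error_rate R g chk y <= eps) && (parity_error_rate R sel y <= eps).

(* Everything announced in a completed session besides g, chk and sel: the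
   Check-mode results of the check rounds, the check bits of the agents, and
   the secret masked by Alice's key. *)
Definition transcript (n m N : nat) : finType :=
  ({ffun 'I_N * 'I_n.+1 -> option bool} * {ffun 'I_n -> bits m} * bits m)%type.

Definition announced (n m N : nat) (chk : modes n N) (sel : selection m N)
    (s : bits m) (y : results n N) : transcript n m N :=
  ([ffun rj => if check_round (chk rj.1) && (rj.2 \in chk rj.1)
               then Some (y rj.1 rj.2) else None],
   [ffun x => check_bits sel y (agent x)],
   bxor s (key sel y ord0)).

(* A general quantum measurement of the memory holding the N probe qubits,
   with outcomes in O, given by its measurement operators. *)
Definition measurement (R : realType) (N : nat) (O : finType)
    (K : O -> opmx R (bits N)) : Prop :=
  \sum_(o : O) ((K o)^t* *m K o) = 1%:M.

Definition prob_measured (R : realType) (n N : nat)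
    (psi : 'I_N -> bits n.+1 * bool -> R[i]) (chk : modes n N)
    (y : results n N) (A : opmx R (bits N)) : R :=
  \sum_(mem : bits N) sqmod (apply_op A (amplitude psi chk y) mem).

Definition distribution (R : realType) (T : finType) (p : T -> R) : Prop :=
  (forall s, 0 <= p s) /\ \sum_(s : T) p s = 1.

Definition uniform (R : realType) (T : finType) : T -> R :=
  fun _ => #|T|%:R^-1.

(* Probability that the session is completed, that its transcript is t, that
   TP then measures the probes with outcome o, and that E holds for the secret
   and the results; p is the law of the secret, and TP chooses its measurement
   K t after having seen the transcript t. *)
Definition prob_view (R : realType) (n m N : nat) (eps : R)
    (g : 'I_N -> ghz_label n) (psi : 'I_N -> bits n.+1 * bool -> R[i])
    (chk : modes n N) (sel : selection m N) (p : bits m -> R) (O : finType)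
    (K : transcript n m N -> O -> opmx R (bits N))
    (t : transcript n m N) (o : O) (E : bits m -> results n N -> bool) : R :=
  \sum_(s : bits m)
    \sum_(y : results n N | [&& completed eps g chk sel y,
                                announced chk sel s y == t & E s y])
      p s * prob_measured psi chk y (K t o).

(* Some final view (t, o) of TP changes the law of Alice's secret. *)
Definition learns_secret (R : realType) (n m N : nat) (eps : R)
    (g : 'I_N -> ghz_label n) (psi : 'I_N -> bits n.+1 * bool -> R[i])
    (chk : modes n N) (sel : selection m N) (O : finType)
    (K : transcript n m N -> O -> opmx R (bits N)) : Prop :=
  exists p : bits m -> R, distribution p /\
  exists (t : transcript n m N) (o : O) (s0 : bits m),
    prob_view eps g psi chk sel p K t o (fun s _ => s == s0)
    <> p s0 * prob_view eps g psi chk sel p K t o (fun _ _ => true).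

(* Given some final view (t, o) of TP, the tuple of the agents' shadows is not
   uniform.  TP knows the law of the shadows that its attack produces, so the
   reference is the uniform law and not that law.  The secret is uniform here:
   the announced mask of a biased secret is by itself correlated with Alice's
   key, hence with the sum of the shadows, even if TP is honest. *)
Definition learns_shadows (R : realType) (n m N : nat) (eps : R)
    (g : 'I_N -> ghz_label n) (psi : 'I_N -> bits n.+1 * bool -> R[i])
    (chk : modes n N) (sel : selection m N) (O : finType)
    (K : transcript n m N -> O -> opmx R (bits N)) : Prop :=
  exists (t : transcript n m N) (o : O) (v : {ffun 'I_n -> bits m}),
    prob_view eps g psi chk sel (@uniform R (bits m)) K t o
      (fun _ y => shadows sel y == v)
    <> uniform R v
       * prob_view eps g psi chk sel (@uniform R (bits m)) K t o
           (fun _ _ => true).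

Definition obtains_information (R : realType) (n m N : nat) (eps : R)
    (g : 'I_N -> ghz_label n) (psi : 'I_N -> bits n.+1 * bool -> R[i])
    : Prop :=
  exists (chk : modes n N) (sel : selection m N), valid_selection chk sel /\
  exists (O : finType) (K : transcript n m N -> O -> opmx R (bits N)),
    (forall t, measurement (K t)) /\
    (learns_secret eps g psi chk sel K \/ learns_shadows eps g psi chk sel K).

(* Main.v *)
(* A unitary that never fails the check of a single fully checked round leaves
   each round in a state |x>|a> + |~x>|b>, where x is the announced string.
   Once every participant has applied H, flipping an even number of the results
   of that round only changes the sign of the amplitude, the same for |a> and
   |b>; so whatever TP measures on its probes depends on the results of a share
   round only through their total parity.  Flips of key bits that keep the
   parity of every round (and flip the secret together with Alice's key, so that
   the announced mask is kept) act transitively on Alice's secret, because there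
   is at least one agent, and on the shadows, because Alice can absorb the
   parity.  Hence the secret and the shadows are independent of TP's view. *)
Require Import Defs.
From mathcomp Require Import all_boot all_order all_algebra.
From mathcomp Require Import reals.

Local Open Scope ring_scope.

Set Implicit Arguments.
Unset Strict Implicit.
Unset Printing Implicit Defensive.

Import Order.TTheory GRing.Theory Num.Theory.

(** * Squared moduli of amplitudes *)

Section Sqmod.
Context {R : realType}.

Lemma sqmod_ge0 (z : R[i]) : 0 <= sqmod z.
Proof. by rewrite addr_ge0 ?sqr_ge0. Qed.

Lemma sqmod_eq0 (z : R[i]) : sqmod z = 0 -> z = 0.
Proof.
case: z => a b /eqP; rewrite /sqmod /= paddr_eq0 ?sqr_ge0 // !sqrf_eq0.
by case/andP => /eqP -> /eqP ->.
Qed.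

Lemma sqmod_sign (k : nat) (z : R[i]) : sqmod ((-1) ^+ k * z) = sqmod z.
Proof.
rewrite -signr_odd; case: (odd k); rewrite ?expr0 ?expr1 ?mul1r // mulN1r.
by case: z => a b; rewrite /sqmod /= !sqrrN.
Qed.

End Sqmod.

Section Bits.
Context {k : nat}.
Implicit Types u v : bits k.

Lemma bxorC u v : bxor u v = bxor v u.
Proof. by apply/ffunP => i; rewrite !ffunE addbC. Qed.

Lemma bxorK v : involutive (fun u => bxor u v).
Proof. by move=> u; apply/ffunP => i; rewrite !ffunE addbK. Qed.

End Bits.

(** * A single round: nonzero states, inversion of the gates, signs under flips *)

Section OneRound.
Context {R : realType} {n : nat}.
Implicit Types (g : ghz_label n) (psi : bits n.+1 * bool -> R[i]).

Lemma bcompl_neq (x : bits n.+1) : (x == bcompl x) = false.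
Proof.
by apply/eqP => /ffunP/(_ ord0); rewrite ffunE; case: (x ord0).
Qed.

Lemma ghz_label_neq0 g : ghz R g g.1 != 0.
Proof.
rewrite /ghz eqxx bcompl_neq mulr0 addr0 mul1r invr_eq0 sqrtC_eq0.
by rewrite pnatr_eq0.
Qed.

Lemma apply_op_inj (T : finType) (A : opmx R T) (f : T -> R[i]) :
  A \in unitmx -> (forall i, apply_op A f i = 0) -> forall i, f i = 0.
Proof.
move=> Aunit Af0 i; pose c : 'cV[R[i]]_#|T| := \col_j f (enum_val j).
suff c0 : c = 0 by move/matrixP/(_ (enum_rank i) ord0): c0; rewrite !mxE enum_rankK.
rewrite -(mulKmx Aunit c); suff -> : A *m c = 0 by rewrite mulmx0.
apply/matrixP => a b; rewrite !mxE -[RHS](Af0 (enum_val a)) /apply_op.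
rewrite (reindex (@enum_rank T)) /=; last first.
  by exists enum_val => j _; rewrite ?enum_rankK ?enum_valK.
by apply: eq_bigr => j _; rewrite mxE enum_rankK enum_valK.
Qed.

(** A unitary is invertible, so a zero output would force a zero input; but the amplitude of the
    input at [(g.1, b)] is a nonzero multiple of [probe b]. *)
Lemma attacked_neq0 (U : opmx R (bits n.+1 * bool)%type)
    (probe : bool -> R[i]) g :
  U \is unitarymx -> \sum_(b : bool) sqmod (probe b) = 1 ->
  exists w, attacked U probe g w != 0.
Proof.
move=> Uu probe1; apply/existsP; apply: contraT; rewrite negb_exists.
move=> /forallP att0.
have v0 := apply_op_inj (unitarymx_unit Uu) (fun w => eqP (negbNE (att0 w))).
suff probe0 b : probe b = 0.
  move: probe1; rewrite big1 => [/eqP|b _].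
    by rewrite eq_sym oner_eq0.
  by rewrite probe0 /sqmod /= expr0n addr0.
move/eqP: (v0 (g.1, b)); rewrite mulf_eq0 /= (negbTE (ghz_label_neq0 g)).
by move/eqP.
Qed.

Lemma after_gates_setT psi y q : after_gates setT psi y q = psi (y, q).
Proof.
rewrite /after_gates (bigD1 y) //= big1 => [|j _]; last by rewrite inE /gate eqxx.
rewrite mul1r big1 ?addr0 // => z zy; suff [j yz] : exists j, y j != z j.
  by rewrite (bigD1 j) //= inE /gate (negbTE yz) !mul0r.
apply/existsP; apply: contraNT zy; rewrite negb_exists => /forallP yz.
by apply/eqP/ffunP => j; apply/esym/eqP/negbNE/yz.
Qed.

Lemma hadamardK (a c : bool) :
  \sum_(b : bool) hadamard R a b * hadamard R b c = (a == c)%:R.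
Proof.
have s2 : sqrtC 2 * sqrtC 2 = 2 :> R[i] by rewrite -expr2 sqrtCK.
have two_neq0 : 2 != 0 :> R[i] by rewrite pnatr_eq0.
have E x y : x / sqrtC 2 * (y / sqrtC 2) = x * y / 2 :> R[i].
  by rewrite mulrACA -invfM s2.
rewrite big_bool /= /hadamard !E -mulrDl.
case: a c => -[] /=; rewrite ?expr0 ?expr1 ?mulrNN ?mulr1 ?mul1r ?addNr ?subrr;
  by rewrite ?mul0r //; apply: (divff two_neq0).
Qed.

(** [H] is an involution, so applying it again to every qubit recovers [psi]. *)
Lemma after_gates_set0_inj psi q :
  (forall y, after_gates set0 psi y q = 0) -> forall z, psi (z, q) = 0.
Proof.
move=> psi0 w.
suff -> : psi (w, q) = \sum_(y : bits n.+1)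
    (\prod_(j < n.+1) hadamard R (w j) (y j)) * after_gates set0 psi y q.
  by rewrite big1 // => y _; rewrite psi0 mulr0.
(* Identity gates expand [psi (w, q)] as a sum over [z], to be matched term by term. *)
rewrite -(after_gates_setT psi w q).
under [RHS]eq_bigr do rewrite mulr_sumr.
rewrite exchange_big; apply: eq_bigr => z _ /=.
under [RHS]eq_bigr do rewrite mulrA -big_split /=.
rewrite -mulr_suml; congr (_ * _).
(* The sum over all strings of a product is the product of the one-bit sums. *)
rewrite -(bigA_distr_bigA (fun j b => hadamard R (w j) b
   * gate R (j \in set0) b (z j))) /=.
by apply: eq_bigr => j _; rewrite !inE /gate hadamardK.
Qed.

(** Entrywise form of [X H = H Z]. *)
Lemma hadamard_flip (a d c : bool) :
  hadamard R (a (+) d) c = (-1) ^+ (d && c) * hadamard R a c.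
Proof.
rewrite /hadamard mulrA; congr (_ / _).
by case: a d c => -[] [] /=; rewrite ?expr0 ?expr1 ?mulrNN ?mulr1 ?mul1r.
Qed.

(** The two sides differ by the factor [(-1)^(d j)] for each [j], and these multiply to 1 as [d] is
    even. *)
Lemma sign_bcompl (d x : bits n.+1) : \big[addb/false]_j d j = false ->
  \prod_j (-1) ^+ (d j && bcompl x j) = \prod_j (-1) ^+ (d j && x j) :> R[i].
Proof.
move=> d_even.
have d1 : \prod_j (-1) ^+ d j = 1 :> R[i].
  transitivity ((-1) ^+ (\big[addb/false]_j d j) : R[i]); last by rewrite d_even.
  by elim/big_rec2: _ => [|j e p _ ->]; rewrite ?expr0 ?signr_addb.
rewrite -[RHS]mul1r -[X in X * _]d1 -big_split /=; apply: eq_bigr => j _.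
by rewrite ffunE; case: (d j) (x j) => -[] /=; rewrite ?expr0 ?expr1 ?mulrNN ?mulr1.
Qed.

Lemma after_gates_flip g psi (d y : bits n.+1) q :
    (forall z q, ghz R g z = 0 -> psi (z, q) = 0) ->
    \big[addb/false]_j d j = false ->
  after_gates set0 psi (bxor y d) q
    = (-1) ^+ (\sum_j (d j && g.1 j))%N * after_gates set0 psi y q.
Proof.
move=> supp d_even; rewrite /after_gates mulr_sumr; apply: eq_bigr => z _.
have [gz0|] := eqVneq (ghz R g z) 0; first by rewrite supp // !mulr0.
move=> gz; rewrite mulrA; congr (_ * _).
rewrite expr_sum.
have -> : \prod_j (-1) ^+ (d j && g.1 j) = \prod_j (-1) ^+ (d j && z j) :> R[i].
  have [->//|zx] := eqVneq z g.1; have [->|zc] := eqVneq z (bcompl g.1).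
    by rewrite sign_bcompl.
  by move: gz; rewrite /ghz (negbTE zx) (negbTE zc) mulr0 addr0 mul0r eqxx.
rewrite -big_split /=; apply: eq_bigr => j _.
by rewrite !inE /gate ffunE hadamard_flip.
Qed.

End OneRound.

(** * Undetectability confines each round to the support of its GHZ state *)

Section Undetected.
Context {R : realType} {n N : nat}.
Variables (g : 'I_N -> ghz_label n) (psi : 'I_N -> bits n.+1 * bool -> R[i]).

Lemma check_round_set0 : check_round (set0 : {set 'I_n.+1}) = false.
Proof.
rewrite /check_round cards0 orbF; apply/negbTE/eqP => /setP/(_ ord0).
by rewrite !inE.
Qed.

(* Only the round r0 is checked, so that its error alone gives the rate 1. *)
Lemma undetected_support (m : nat) (eps : R) : eps < 1 ->
  undetected m eps g psi -> (forall r, exists w, psi r w != 0) ->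
  forall r z q, ghz R (g r) z = 0 -> psi r (z, q) = 0.
Proof.
move=> eps_lt1 [undet _] psi_neq0 r0 z q gz0.
pose chk : modes n N := fun r => if r == r0 then setT else set0.
(* The other rounds need an outcome of nonzero amplitude, so that a vanishing product can only come
   from the factor of [r0]. *)
have wit r : exists yq : bits n.+1 * bool,
    after_gates set0 (psi r) yq.1 yq.2 != 0.
  apply/existsP; apply: contraT; rewrite negb_exists => /forallP all0.
  have [[w p]] := psi_neq0 r; rewrite (@after_gates_set0_inj _ _ _ p) ?eqxx //.
  by move=> y; apply/eqP/negbNE/(all0 (y, p)).
pose yq r := xchoose (wit r).
pose y : results n N := [ffun r => if r == r0 then z else (yq r).1].
pose mem : bits N := [ffun r => if r == r0 then q else (yq r).2].
have chkE r : check_round (chk r) = (r == r0).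
  by rewrite /chk; case: eqP => _; rewrite ?check_round_set0 // /check_round eqxx.
have nconf : conforms R (g r0) (chk r0) (y r0) = false.
  apply/negbTE/existsPn => z'; rewrite negb_and /chk /y eqxx ffunE eqxx.
  have [->|] := eqVneq z' z; first by rewrite gz0 eqxx.
  apply: contraNT; rewrite negb_or => /andP[_ /negbNE/forallP zz'].
  by apply/eqP/ffunP => j; move/(_ j): zz'; rewrite inE => /eqP.
have rate1 : eps < check_error_rate R g chk y.
  rewrite /check_error_rate.
  have -> : [set r | check_round (chk r) && ~~ conforms R (g r) (chk r) (y r)]
      = [set r0].
    apply/setP => r; rewrite !inE chkE; case: eqP => // ->.
    by rewrite nconf.
  have -> : [set r | check_round (chk r)] = [set r0].
    by apply/setP => r; rewrite !inE chkE.
  by rewrite cards1 divr1.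
(* A zero sum of nonnegative terms has only zero terms. *)
have amp0 : amplitude psi chk y mem = 0.
  apply/sqmod_eq0.
  have /eqP := undet chk; rewrite /prob_results psumr_eq0; last first.
    by move=> ? _; apply: sumr_ge0 => ? _; apply: sqmod_ge0.
  move/allP/(_ y (mem_index_enum _)); rewrite rate1 /= psumr_eq0; last first.
    by move=> ? _; apply: sqmod_ge0.
  by move/allP/(_ mem (mem_index_enum _))/eqP.
move/eqP: amp0; rewrite prodf_seq_eq0 => /hasP[r _] /=.
rewrite /chk /y /mem !ffunE; have [->|_] := eqVneq r r0.
  by rewrite after_gates_setT => /eqP.
by rewrite (negbTE (xchooseP (wit r))).
Qed.

End Undetected.

(** * Parity-preserving flips of key bits, and independence from the view *)

Section Flips.
Context {R : realType} {n m N : nat}.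
Variables (eps : R) (g : 'I_N -> ghz_label n).
Variables (psi : 'I_N -> bits n.+1 * bool -> R[i]).
Hypothesis supp : forall r z q, ghz R (g r) z = 0 -> psi r (z, q) = 0.
Variables (chk : modes n N) (sel : selection m N).
Hypothesis sel_valid : valid_selection chk sel.
Implicit Types (T : {ffun 'I_n.+1 -> bits m}) (y : results n N).

Definition even_flip T := forall i, \big[addb/false]_j T j i = false.

(** The masks [T] are indexed by key position; [pick] finds the position that a round serves, unique
    by injectivity of [sel]. *)
Definition round_flip T (r : 'I_N) : bits n.+1 :=
  [ffun j => if [pick i | sel (inr i) == r] is Some i then T j i else false].

Definition flip_keys T y : results n N :=
  [ffun r => bxor (y r) (round_flip T r)].

Lemma flip_keysK T : involutive (flip_keys T).
Proof. by move=> y; apply/ffunP => r; rewrite !ffunE bxorK. Qed.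

Lemma flip_keys_id T y r :
  (forall i, sel (inr i) != r) -> flip_keys T y r = y r.
Proof.
move=> selr; apply/ffunP => j; rewrite !ffunE; case: pickP => [i|_].
  by rewrite (negbTE (selr i)).
by rewrite addbF.
Qed.

Lemma flip_keys_check T y r : check_round (chk r) -> flip_keys T y r = y r.
Proof.
move=> chk_r; apply: flip_keys_id => i; apply: contraTneq chk_r => <-.
by case: sel_valid => _ /(_ (inr i))/eqP ->; rewrite check_round_set0.
Qed.

(** Injectivity of [sel] keeps check-bit rounds apart from key rounds. *)
Lemma check_bits_flip T y : check_bits sel (flip_keys T y) =1 check_bits sel y.
Proof.
move=> j; apply/ffunP => i; rewrite !ffunE.
case: pickP => [k /eqP/(proj1 sel_valid)//|_].
by rewrite addbF.
Qed.

Lemma key_flip T y j : key sel (flip_keys T y) j = bxor (key sel y j) (T j).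
Proof.
apply/ffunP => i; rewrite !ffunE; congr (_ (+) _).
case: pickP => [k /eqP/(proj1 sel_valid) [->]//|/(_ i)].
by rewrite eqxx.
Qed.

Lemma completed_flip T y :
  completed eps g chk sel (flip_keys T y) = completed eps g chk sel y.
Proof.
congr (_ && _).
  congr (_ / _ <= _); congr (_ %:R); apply: eq_card => r; rewrite !inE.
  by case chk_r: (check_round _) => //=; rewrite flip_keys_check.
congr (_ / _ <= _); congr (_ %:R); apply: eq_card => i; rewrite !inE.
by rewrite check_bits_flip; under eq_bigr do rewrite check_bits_flip.
Qed.

Lemma announced_flip T y s :
  announced chk sel (bxor s (T ord0)) (flip_keys T y) = announced chk sel s y.
Proof.
rewrite /announced; congr (_, _, _).
- apply/ffunP => -[r j]; rewrite [LHS]ffunE [RHS]ffunE /=.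
  by case: ifP => // /andP[chk_r _]; rewrite flip_keys_check.
- by apply/ffunP => x; rewrite [LHS]ffunE [RHS]ffunE check_bits_flip.
- rewrite key_flip; move: (key sel y ord0) => k; apply/ffunP => i.
  by rewrite !ffunE; case: (s i) (T ord0 i) (k i) => -[] [].
Qed.

Lemma round_flip_even T r : even_flip T ->
  \big[addb/false]_j round_flip T r j = false.
Proof.
move=> T_even; under eq_bigr do rewrite ffunE.
by case: pickP => [i _|_]; [apply: T_even|apply: big1].
Qed.

(** As [k] is chosen before [mem], the sign is a global phase of the memory, invisible to any
    measurement. *)
Lemma amplitude_flip T y : even_flip T -> exists k : nat, forall mem,
  amplitude psi chk (flip_keys T y) mem = (-1) ^+ k * amplitude psi chk y mem.
Proof.
move=> T_even.
exists (\sum_r \sum_j (round_flip T r j && (g r).1 j))%N => mem.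
rewrite expr_sum -big_split; apply: eq_bigr => r _ /=.
have [/existsP[i /eqP <-]|] := boolP [exists i, sel (inr i) == r].
  have /eqP -> := (proj2 sel_valid) (inr i).
  rewrite ffunE; apply: after_gates_flip; first exact: supp.
  exact: round_flip_even.
move=> /existsPn selr; rewrite flip_keys_id // big1 ?mul1r // => j _.
by rewrite ffunE; case: pickP => // i; rewrite (negbTE (selr i)).
Qed.

Lemma prob_measured_flip T y (A : opmx R (bits N)) : even_flip T ->
  prob_measured psi chk (flip_keys T y) A = prob_measured psi chk y A.
Proof.
move=> /(amplitude_flip y)[k ampE]; apply: eq_bigr => mem _.
rewrite -[RHS](sqmod_sign k); congr sqmod; rewrite /apply_op mulr_sumr.
by apply: eq_bigr => mem' _; rewrite ampE mulrCA.
Qed.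

Variables (O : finType) (K : transcript n m N -> O -> opmx R (bits N)).
Variables (t : transcript n m N) (o : O).

(** Likelihood of the view [(t, o)] when the secret is [s]. *)
Definition view_given (s : bits m) (E : pred (results n N)) : R :=
  \sum_(y | [&& completed eps g chk sel y, announced chk sel s y == t & E y])
    prob_measured psi chk y (K t o).

Lemma prob_viewE p E : prob_view eps g psi chk sel p K t o E
  = \sum_s p s * view_given s (E s).
Proof. by apply: eq_bigr => s _; rewrite mulr_sumr. Qed.

Lemma view_given_flip T s E : even_flip T ->
  view_given (bxor s (T ord0)) E = view_given s (E \o flip_keys T).
Proof.
move=> T_even; rewrite /view_given (reindex_inj (inv_inj (flip_keysK T))) /=.
apply: eq_big => [y|y _]; last exact: prob_measured_flip.
by rewrite completed_flip announced_flip.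
Qed.

Lemma view_given_indep s s' : (0 < n)%N ->
  view_given s xpredT = view_given s' xpredT.
Proof.
move=> n_gt0; pose x := agent (Ordinal n_gt0).
(* Alice and one agent flip by the same mask, which turns [s'] into [s] and keeps parities. *)
pose T : {ffun 'I_n.+1 -> bits m} :=
  [ffun j => if (j == ord0) || (j == x) then bxor s' s else [ffun=> false]].
have T_even : even_flip T.
  move=> i; rewrite (bigD1 ord0) // (bigD1 x) //= big1 => [|j /andP[j0 jx]].
    by rewrite !ffunE addbF addbb.
  by rewrite ffunE (negbTE j0) (negbTE jx) ffunE.
have := view_given_flip s' xpredT T_even.
rewrite ffunE eqxx /= => <-; congr view_given.
by rewrite bxorC (bxorC s') bxorK.
Qed.

(** A likelihood that is constant in the secret leaves its law unchanged. *)
Lemma no_secret p s0 : (0 < n)%N -> distribution p ->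
  prob_view eps g psi chk sel p K t o (fun s _ => s == s0)
  = p s0 * prob_view eps g psi chk sel p K t o (fun _ _ => true).
Proof.
move=> n_gt0 [_ p1]; rewrite !prob_viewE.
under [in RHS]eq_bigr do rewrite (view_given_indep _ s0 n_gt0).
rewrite -mulr_suml p1 mul1r (bigD1 s0) //= [X in _ + X]big1 ?addr0.
  by rewrite eqxx.
move=> s /negbTE ss0; rewrite /view_given big_pred0 ?mulr0 // => y.
by rewrite ss0 !andbF.
Qed.

(** Alice's compensating flip also moves the secret, so only the sum over all secrets is
    invariant. *)
Lemma shadows_indep v v' :
  \sum_s view_given s (fun y => shadows sel y == v)
  = \sum_s view_given s (fun y => shadows sel y == v').
Proof.
pose d : 'I_n -> bits m := fun x => bxor (v x) (v' x).
pose T : {ffun 'I_n.+1 -> bits m} :=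
  [ffun j => if unlift ord0 j is Some x then d x
             else [ffun i => \big[addb/false]_x d x i]].
have T_agent x : T (agent x) = d x by rewrite ffunE liftK.
have T_even : even_flip T.
  move=> i; rewrite big_ord_recl ffunE unlift_none ffunE.
  by rewrite -[RHS](addbb (\big[addb/false]_x d x i)); congr (_ (+) _);
     apply: eq_bigr => x _; rewrite -/(agent x) T_agent.
rewrite (reindex_inj (inv_inj (bxorK (T ord0)))) /=; apply: eq_bigr => s _.
rewrite view_given_flip //; apply: eq_bigl => y /=; do 2! congr (_ && _).
have shE : forall x, shadows sel (flip_keys T y) x = bxor (shadows sel y x) (d x).
  by move=> x; rewrite !ffunE key_flip T_agent.
move: (shadows sel (flip_keys T y)) (shadows sel y) shE => w' w shE.
have wE x : w x = bxor (w' x) (d x) by rewrite shE bxorK.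
apply/eqP/eqP => [w'v|wv]; apply/ffunP => x.
  by rewrite wE w'v /d bxorC (bxorC (v x)) bxorK.
by rewrite shE wv /d bxorC bxorK.
Qed.

Lemma no_shadows v :
  prob_view eps g psi chk sel (@uniform R (bits m)) K t o
    (fun _ y => shadows sel y == v)
  = uniform R v * prob_view eps g psi chk sel (@uniform R (bits m)) K t o
      (fun _ _ => true).
Proof.
rewrite !prob_viewE -!mulr_sumr mulrCA; congr (_ * _).
(* The total splits into equal shares, one for each value of the shadows. *)
have -> : \sum_s view_given s xpredT
    = \sum_v' \sum_s view_given s (fun y => shadows sel y == v').
  rewrite exchange_big; apply: eq_bigr => s _; rewrite /view_given.
  rewrite (partition_big (fun y => shadows sel y) xpredT) //=.
  by apply: eq_bigr => v' _; apply: eq_bigl => y; rewrite andbT andbA.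
under [in RHS]eq_bigr do rewrite (shadows_indep _ v).
rewrite sumr_const -[X in _ = _ * X]mulr_natl mulrA mulVf ?mul1r //.
by rewrite pnatr_eq0 -lt0n; apply/card_gt0P; exists v.
Qed.

End Flips.

Theorem theorem1 (R : realType) (n m N : nat) (eps : R)
    (g : 'I_N -> ghz_label n) (probe : bool -> R[i]) :
  (0 < n)%N -> 0 <= eps < 1 -> \sum_(b : bool) sqmod (probe b) = 1 ->
  ~ exists U : opmx R (bits n.+1 * bool)%type,
      U \is unitarymx
      /\ undetected m eps g (fun r => attacked U probe (g r))
      /\ obtains_information m eps g (fun r => attacked U probe (g r)).
Proof.
move=> n_gt0 /andP[_ eps_lt1] probe1 [U [Uu [undet]]].
have supp := undetected_support eps_lt1 undet
  (fun r => attacked_neq0 (g r) Uu probe1).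
case=> chk [sel [sel_valid [O [K [_ []]]]]].
  case=> p [p_distr [t [o [s0]]]]; apply.
  exact: no_secret.
case=> t [o [v]]; apply.
exact: no_shadows.
Qed.
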